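(* Let $O$ be the origin of $\mathbb{R}^2$ and let $P,P'\in\mathbb{R}^2$ be such that $O,P,P'$ are not collinear. Let $J=\{Q\in\mathbb{R}^2:\ \|Q\|^2,\|Q-P\|^2,\|Q-P'\|^2\in\mathbb{Q}\}$ and $J^*=\{Q\in\mathbb{R}^2:\ \|Q\|,\|Q-P\|,\|Q-P'\|\in\mathbb{Q}\}$. If $\|P\|^2, P\cdot P', \|P'\|^2\in\mathbb{Q}$, then $J^*$ is Zariski-dense in the plane if and only if there exists a point of $\mathbb{Q}P+\mathbb{Q}P'$ with nonzero rational distance from $O$. If instead $\|P\|^2,P\cdot P',\|P'\|^2$ are not all rational, then $J$ (and hence $J^*$) is not Zariski-dense.
   Context: $\|\cdot\|$ is the Euclidean norm, $P\cdot P'$ the standard scalar product; $\mathbb{Q}P+\mathbb{Q}P'$ is the set of rational linear combinations of the vectors $P,P'$. *)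

(* Defs.v *)
From HB Require Import structures.
From mathcomp Require Import all_boot all_order all_algebra.
From mathcomp Require Import mpoly.
From mathcomp Require Import classical_sets reals.

Set Implicit Arguments.
Unset Strict Implicit.
Unset Printing Implicit Defensive.

Import Order.TTheory GRing.Theory Num.Theory.

Local Open Scope classical_set_scope.
Local Open Scope ring_scope.

Definition dot (R : realType) (P Q : 'rV[R]_2) : R := \sum_(i < 2) P 0 i * Q 0 i.

(* Not the norm that MathComp-Analysis puts on 'rV_2, which is the sup norm. *)
Definition enorm (R : realType) (P : 'rV[R]_2) : R := Num.sqrt (dot P P).

Definition collinear (R : realType) (A B C : 'rV[R]_2) : Prop :=
  exists X v : 'rV[R]_2, v != 0 /\
    [set A; B; C] `<=` [set X + t *: v | t in [set: R]].

Definition rat_comb (R : realType) (P P' : 'rV[R]_2) : set 'rV[R]_2 :=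
  [set Q | exists a b : rat, Q = ratr a *: P + ratr b *: P'].

Definition zero_locus (R : realType) (I : set {mpoly R[2]}) : set 'rV[R]_2 :=
  [set Q : 'rV[R]_2 | forall f, I f -> f.@[Q 0] = 0].

Definition zariski_closed (R : realType) (Z : set 'rV[R]_2) : Prop :=
  exists I : set {mpoly R[2]}, Z = zero_locus I.

Definition zariski_closure (R : realType) (S : set 'rV[R]_2) : set 'rV[R]_2 :=
  \bigcap_(Z in [set Z | zariski_closed Z /\ S `<=` Z]) Z.

Definition zariski_dense (R : realType) (S : set 'rV[R]_2) : Prop :=
  zariski_closure S = [set: 'rV[R]_2].

Definition J (R : realType) (P P' : 'rV[R]_2) : set 'rV[R]_2 :=
  [set Q | [/\ rational (enorm Q ^+ 2),
               rational (enorm (Q - P) ^+ 2) &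
               rational (enorm (Q - P') ^+ 2)]].

Definition Jstar (R : realType) (P P' : 'rV[R]_2) : set 'rV[R]_2 :=
  [set Q | [/\ rational (enorm Q), rational (enorm (Q - P)) &
               rational (enorm (Q - P'))]].

(* Main.v *)
Require Import Defs.
From HB Require Import structures.
From mathcomp Require Import all_boot all_order all_algebra.
From mathcomp Require Import mpoly.
From mathcomp Require Import classical_sets reals.
From mathcomp Require Import boolp ring lra.

Set Implicit Arguments.
Unset Strict Implicit.
Unset Printing Implicit Defensive.

Import Order.TTheory GRing.Theory Num.Theory.

Local Open Scope classical_set_scope.
Local Open Scope ring_scope.

(* Nonrational case.  For [Q] in [J] the numbers [p = 2 Q.P - |P|^2] and
   [q = 2 Q.P' - |P'|^2] are rational, and the Gram determinant of [Q, P, P']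
   expresses the rational number [|Q|^2] as a quadratic polynomial in [p, q]
   with coefficients depending on [P] and [P'].
   If [J] is dense, the values of [p^2, pq, q^2, p, q, 1] on [J] span [Q^6], so
   the coefficients of that polynomial are rational, and so are [|P|^2], [P.P']
   and [|P'|^2].

   Rational case.  Density yields a nonzero point of [J*], and its rational
   scalar products with [P], [P'] put it in [QP + QP'].  Conversely, a rational
   unit vector [e] of [QP + QP'] gives infinitely many others, say [u].  The points of
   [J*] on the line [R u] are the rational points of a curve of genus 1 with
   rational points at infinity, on which a translation is composed of two
   explicit involutions.  Letting [u] move to the (real) direction of [P'], the
   curve degenerates and the translation becomes a homography with real fixed
   points whose multiplier is not a root of unity, unless [P.P' = |P'|^2], in
   which case [P] and [P'] are exchanged.  Hence for every [N], the orbit gives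
   [N] distinct points on [R u] for all but finitely many [u], and a polynomial
   vanishing on [J*] vanishes on infinitely many lines through [O]. *)

(** * Rational functions near a point and generic properties *)

(** A condition checked at the single point [x0] is spread to all but finitely many [x], the
    polynomial [q] being nonzero. *)
Definition generic (R : fieldType) (x0 : R) (S : R -> Prop) : Prop :=
  exists2 q : {poly R}, q.[x0] != 0 & forall x, q.[x] != 0 -> S x.

(** Nothing is asked where [q] vanishes, so the value that a total inverse takes at a pole does not
    matter. *)
Definition regular_at (R : fieldType) (x0 : R) (g : R -> R) : Prop :=
  exists p q : {poly R},
    q.[x0] != 0 /\ forall x, q.[x] != 0 -> g x = p.[x] / q.[x].

Lemma generic_and (R : fieldType) (x0 : R) (S S' : R -> Prop) :
  generic x0 S -> generic x0 S' -> generic x0 (fun x => S x /\ S' x).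
Proof.
move=> [q q0 Sq] [q' q'0 Sq']; exists (q * q'); first by rewrite hornerM mulf_neq0.
by move=> x; rewrite hornerM mulf_eq0 negb_or => /andP[/Sq ? /Sq' ?].
Qed.

Lemma generic_forall (R : fieldType) (x0 : R) n (S : nat -> R -> Prop) :
  (forall i, (i < n)%N -> generic x0 (S i)) ->
  generic x0 (fun x => forall i, (i < n)%N -> S i x).
Proof.
elim: n => [|n IHn] hS.
  by exists 1 => //; rewrite hornerC oner_eq0.
have [q q0 Sq] := generic_and (IHn (fun i hi => hS i (ltnW hi))) (hS n (ltnSn n)).
exists q => // x /Sq[hx hn] i; rewrite ltnS leq_eqVlt => /predU1P[->//|].
exact: hx.
Qed.

Lemma regular_at_cst (R : fieldType) (x0 c : R) : regular_at x0 (fun=> c).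
Proof.
by exists c%:P, 1; split=> [|x _]; rewrite !hornerC ?oner_eq0 // divr1.
Qed.

Lemma regular_atD (R : fieldType) (x0 : R) (g h : R -> R) :
  regular_at x0 g -> regular_at x0 h -> regular_at x0 (fun x => g x + h x).
Proof.
move=> [p [q [q0 gE]]] [p' [q' [q'0 hE]]].
exists (p * q' + p' * q), (q * q'); split; first by rewrite hornerM mulf_neq0.
move=> x; rewrite hornerD !hornerM mulf_eq0 negb_or => /andP[qx q'x].
by rewrite gE // hE // addf_div.
Qed.

Lemma regular_atM (R : fieldType) (x0 : R) (g h : R -> R) :
  regular_at x0 g -> regular_at x0 h -> regular_at x0 (fun x => g x * h x).
Proof.
move=> [p [q [q0 gE]]] [p' [q' [q'0 hE]]].
exists (p * p'), (q * q'); split; first by rewrite hornerM mulf_neq0.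
move=> x; rewrite !hornerM mulf_eq0 negb_or => /andP[qx q'x].
by rewrite gE // hE // mulf_div.
Qed.

Lemma regular_atN (R : fieldType) (x0 : R) (g : R -> R) :
  regular_at x0 g -> regular_at x0 (fun x => - g x).
Proof.
move=> [p [q [q0 gE]]]; exists (- p), q; split=> // x qx.
by rewrite gE // hornerN mulNr.
Qed.

Lemma regular_atV (R : fieldType) (x0 : R) (g : R -> R) :
  regular_at x0 g -> g x0 != 0 -> regular_at x0 (fun x => (g x)^-1).
Proof.
move=> [p [q [q0 gE]]]; rewrite gE // mulf_eq0 negb_or => /andP[p0 _].
(* The factor [q] is kept on both sides so that the new denominator also excludes the points where
   [g] is not known to be [p / q]. *)
exists (q * q), (p * q); split; first by rewrite hornerM mulf_neq0.
move=> x; rewrite !hornerM mulf_eq0 negb_or => /andP[px qx].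
by rewrite gE // invf_div -mulf_div divff // mulr1.
Qed.

Lemma generic_neq0 (R : fieldType) (x0 : R) (g : R -> R) :
  regular_at x0 g -> g x0 != 0 -> generic x0 (fun x => g x != 0).
Proof.
move=> [p [q [q0 gE]]]; rewrite gE // mulf_eq0 negb_or => /andP[p0 _].
exists (p * q); first by rewrite hornerM mulf_neq0.
move=> x; rewrite !hornerM mulf_eq0 negb_or => /andP[px qx].
by rewrite gE // mulf_neq0 ?invr_eq0.
Qed.

(** * The orbit on the curve of genus 1 and its degeneration *)

(* With [Q = l u], [u] a unit vector, [m = l - |Q - P|] and
   [k = |Q - P| + |Q - P'|], the distances from [P] and [P'] become the curve
   [(m^2 - A) (k + m - b) = ((k + m)^2 - B) (m - a)], where [a = u.P],
   [b = u.P'], [A = |P|^2], [B = |P'|^2].  It is quadratic in [m] and in [k];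
   each step replaces [m], then [k], by the other root.  The starting point is
   what the step makes of the point at infinity [m = k = oo]. *)
Fixpoint orbit (R : fieldType) (a b A B : R) (n : nat) : R * R :=
  if n is n'.+1 then
    let z := orbit a b A B n' in
    let m := - (z.2 * z.2 - 2 * a * z.2 + A - B) / (z.2 + b - a) - z.1 in
    (m, - (m * m - 2 * a * m + A) / (m - a) - z.2)
  else (a, b - a).

Definition orbit_defined (R : fieldType) (a b A B : R) (n : nat) : Prop :=
  forall i, (i < n)%N ->
    ((orbit a b A B i).2 + b - a != 0) /\ ((orbit a b A B i.+1).1 - a != 0).

(** This [l] solves [l ^+ 2 - 2 * l * a + A = (l - m) ^+ 2], which is linear in [l]. At [n = 0] one
    has [m = a] and [l] is at infinity, hence the index [n.+1] in what follows. *)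
Definition orbit_dist (R : fieldType) (a b A B : R) (n : nat) : R :=
  let m := (orbit a b A B n).1 in (m * m - A) / (2 * (m - a)).

(** Vieta: a quadratic takes equal values at two arguments that add up to the sum of its roots. At
    the start [k + m - b] and [m - a] both vanish. *)
Lemma orbit_curve (R : fieldType) (a b A B : R) n : orbit_defined a b A B n ->
  let m := (orbit a b A B n).1 in let k := (orbit a b A B n).2 in
  (m * m - A) * (k + m - b) = ((k + m) * (k + m) - B) * (m - a).
Proof.
elim: n => [|n IHn] dn /=; first by ring.
have /= [] := dn n (ltnSn n).
have /= {IHn} := IHn (fun i hi => dn i (ltnW hi)).
case: (orbit a b A B n) => m k /= cmk k0.
set m' := - _ / _ - m => m'0.
have cm'k : (m' * m' - A) * (k + m' - b) = ((k + m') * (k + m') - B) * (m' - a).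
  apply/eqP; rewrite -subr_eq0; apply/eqP.
  move/eqP: cmk; rewrite -subr_eq0 => /eqP cmk; rewrite -[RHS]cmk /m'.
  by field.
apply/eqP; rewrite -subr_eq0; apply/eqP.
move/eqP: cm'k; rewrite -subr_eq0 => /eqP cm'k; rewrite -[RHS]cm'k.
by field.
Qed.

(** Once [l ^+ 2] cancels, the equations are [2 * l * (m - a) = m * m - A] and
    [2 * l * (k + m - b) = (k + m) ^+ 2 - B]; the curve expresses their compatibility. *)
Lemma orbit_dist_sqr (R : numFieldType) (a b A B : R) n :
  orbit_defined a b A B n.+1 ->
  let l := orbit_dist a b A B n.+1 in
  let m := (orbit a b A B n.+1).1 in let k := (orbit a b A B n.+1).2 in
  l ^+ 2 - 2 * l * a + A = (l - m) ^+ 2 /\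
  l ^+ 2 - 2 * l * b + B = (k - l + m) ^+ 2.
Proof.
move=> dn; rewrite /orbit_dist.
have := orbit_curve dn.
have [_] := dn n (ltnSn n).
move: (orbit a b A B n.+1) => -[m k] /= ma cmk; split; first by field.
apply/eqP; rewrite -subr_eq0 -(mulrI_eq0 _ (mulfI ma)); apply/eqP.
move/eqP: cmk; rewrite -subr_eq0 => /eqP cmk; rewrite -[RHS]cmk.
by field.
Qed.

(** The iterates keep the sign of [T], so the recursion never divides by zero. *)
Lemma ratio_pos (R : realFieldType) (T C : R) n : T != 0 -> 0 < C ->
  0 < T * iter n (fun r => T + C / r) T.
Proof.
move=> T0 C0; elim: n => [|n /=]; first by rewrite -expr2 exprn_even_gt0.
set r := iter n _ _ => Tr0.
have r0 : r != 0 by apply: contraTneq Tr0 => ->; rewrite mulr0 ltxx.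
have -> : T * (T + C / r) = T ^+ 2 + C * (T * r) * (r^-1) ^+ 2 by field.
rewrite addr_gt0 ?(mulr_gt0 (mulr_gt0 C0 Tr0)) //; first by rewrite exprn_even_gt0.
by rewrite exprn_even_gt0 //= invr_eq0.
Qed.

(** The homography [r -> T + C / r] is injective and its iterates never return to [T], which is the
    image of infinity. *)
Lemma ratio_inj (R : realFieldType) (T C : R) : T != 0 -> 0 < C ->
  injective (fun n => iter n (fun r => T + C / r) T).
Proof.
move=> T0 C0.
have r0 n : iter n (fun r => T + C / r) T != 0.
  by have := ratio_pos n T0 C0; apply: contraTneq => ->; rewrite mulr0 ltxx.
have rT n : iter n.+1 (fun r => T + C / r) T != T.
  by rewrite /= -subr_eq0 addrC addKr mulf_neq0 ?invr_eq0 // gt_eqF.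
elim=> [|i IHi] [|j] // => [/esym /eqP|/eqP|/= /addrI /mulfI H].
- by rewrite (negPf (rT _)).
- by rewrite (negPf (rT _)).
by congr _.+1; apply/IHi/invr_inj/H; rewrite gt_eqF.
Qed.

(* [B = b^2] is the case where [u] is parallel to [P']: the curve then splits
   into a line and a conic, and two successive steps act on the line as a
   homography with real fixed points. *)
Lemma orbit_degenerate (R : realFieldType) (a b A : R) n :
  a != b -> a ^+ 2 < A ->
  let r := iter n (fun r => 2 * (b - a) + (A - a ^+ 2) / r) (2 * (b - a)) in
  orbit a b A (b ^+ 2) n = (2 * b - a - r, r + a - b).
Proof.
move=> ab aA; rewrite -subr_gt0 in aA.
have T0 : 2 * (b - a) != 0.
  by rewrite mulf_neq0 ?pnatr_eq0 // subr_eq0 eq_sym.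
elim: n => [|n IHn] /=; first by congr pair; ring.
have := ratio_pos n T0 aA.
rewrite {}IHn /=; set r := iter n _ _ => Tr0.
have r0 : r != 0 by apply: contraTneq Tr0 => ->; rewrite mulr0 ltxx.
have -> : r + a - b + b - a = r by ring.
have -> : - ((r + a - b) * (r + a - b) - 2 * a * (r + a - b) + A - b ^+ 2) / r
  - (2 * b - a - r) = 2 * b - a - (2 * (b - a) + (A - a ^+ 2) / r).
  by field.
congr pair.
have -> : 2 * b - a - (2 * (b - a) + (A - a ^+ 2) / r) - a = - ((A - a ^+ 2) / r).
  by ring.
by field; rewrite r0 gt_eqF.
Qed.

Lemma orbit_degenerate_defined (R : realFieldType) (a b A : R) n :
  a != b -> a ^+ 2 < A -> orbit_defined a b A (b ^+ 2) n.
Proof.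
move=> ab aA i _; rewrite !orbit_degenerate //=.
have aA' := aA; rewrite -subr_gt0 in aA'.
have T0 : 2 * (b - a) != 0 by rewrite mulf_neq0 ?pnatr_eq0 // subr_eq0 eq_sym.
have := ratio_pos i T0 aA'.
set r := iter i _ _ => Tr0.
have r0 : r != 0 by apply: contraTneq Tr0 => ->; rewrite mulr0 ltxx.
have -> : r + a - b + b - a = r by ring.
have -> : 2 * b - a - (2 * (b - a) + (A - a ^+ 2) / r) - a = - ((A - a ^+ 2) / r).
  by ring.
by rewrite oppr_eq0 mulf_neq0 ?invr_eq0 // gt_eqF.
Qed.

(** With [C = A - a ^+ 2 > 0] the distance is [a + (r - C / r) / 2], and [r - C / r] is increasing
    on the half-line that contains all the iterates [r]. *)
Lemma orbit_degenerate_dist_inj (R : realFieldType) (a b A : R) :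
  a != b -> a ^+ 2 < A ->
  injective (fun n => orbit_dist a b A (b ^+ 2) n.+1).
Proof.
move=> ab aA; have aA' := aA; rewrite -subr_gt0 in aA'.
have T0 : 2 * (b - a) != 0 by rewrite mulf_neq0 ?pnatr_eq0 // subr_eq0 eq_sym.
set C := A - a ^+ 2 in aA'.
pose r n := iter n (fun r => 2 * (b - a) + C / r) (2 * (b - a)).
have Tr_gt0 n : 0 < 2 * (b - a) * r n := ratio_pos n T0 aA'.
have r0 n : r n != 0 by apply: contraTneq (Tr_gt0 n) => ->; rewrite mulr0 ltxx.
have distE n : orbit_dist a b A (b ^+ 2) n.+1 = a + (r n - C / r n) / 2.
  rewrite /orbit_dist orbit_degenerate //=.
  rewrite -/C -/(r n).
  have -> : 2 * b - a - (2 * (b - a) + C / r n) = a - C / r n by ring.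
  have -> : A = C + a ^+ 2 by rewrite subrK.
  have -> : a - C / r n - a = - (C / r n) by ring.
  by field; rewrite r0 gt_eqF.
move=> i j /=; rewrite !distE => /addrI /(mulIf _) H.
apply: (ratio_inj T0 aA') => /=; rewrite -/(r i) -/(r j).
have {}H : r i - C / r i = r j - C / r j by apply: H; rewrite invr_eq0 pnatr_eq0.
have rr : 0 < r i * r j.
  rewrite -(pmulr_rgt0 _ (_ : 0 < (2 * (b - a)) ^+ 2)) ?exprn_even_gt0 //.
  by rewrite expr2 mulrACA mulr_gt0.
have : (r i - r j) * (1 + C / (r i * r j)) = 0.
  have -> : (r i - r j) * (1 + C / (r i * r j)) =
    (r i - C / r i) - (r j - C / r j) by field; rewrite !r0.
  by rewrite H subrr.
move/eqP; rewrite mulf_eq0 subr_eq0 => /orP[/eqP //|].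
by rewrite gt_eqF // addr_gt0 // divr_gt0.
Qed.

(** The only denominators met are those that [orbit_defined] makes nonzero at [x0]. *)
Lemma orbit_regular (R : fieldType) (x0 A B : R) (a b : R -> R) n :
  regular_at x0 a -> regular_at x0 b -> orbit_defined (a x0) (b x0) A B n ->
  regular_at x0 (fun x => (orbit (a x) (b x) A B n).1) /\
  regular_at x0 (fun x => (orbit (a x) (b x) A B n).2).
Proof.
move=> ra rb; elim: n => [|n IHn] dn /=.
  by split=> //; apply: regular_atD => //; apply: regular_atN.
have [rm rk] := IHn (fun i hi => dn i (ltnW hi)).
have [k0 m0] := dn n (ltnSn n).
have rm' : regular_at x0 (fun x => (orbit (a x) (b x) A B n.+1).1).
  apply: regular_atD; last exact: regular_atN.
  apply: regular_atM; last first.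
    by apply: regular_atV => //; do !apply: regular_atD => //; apply: regular_atN.
  apply: regular_atN; apply: regular_atD; last exact: regular_atN (regular_at_cst _ _).
  apply: regular_atD; last exact: regular_at_cst.
  apply: regular_atD; first exact: regular_atM.
  apply: regular_atN; apply: regular_atM => //.
  by apply: regular_atM => //; apply: regular_at_cst.
split=> //; apply: regular_atD; last exact: regular_atN.
apply: regular_atM; last first.
  by apply: regular_atV => //; apply: regular_atD => //; apply: regular_atN.
apply: regular_atN; apply: regular_atD; last exact: regular_at_cst.
apply: regular_atD; first exact: regular_atM.
apply: regular_atN; apply: regular_atM => //.
by apply: regular_atM => //; apply: regular_at_cst.
Qed.

Lemma orbit_dist_regular (R : numFieldType) (x0 A B : R) (a b : R -> R) n :
  regular_at x0 a -> regular_at x0 b -> orbit_defined (a x0) (b x0) A B n.+1 ->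
  regular_at x0 (fun x => orbit_dist (a x) (b x) A B n.+1).
Proof.
move=> ra rb dn; have [rm _] := orbit_regular ra rb dn.
have [_ m0] := dn n (ltnSn n).
apply: regular_atM.
  by apply: regular_atD; [apply: regular_atM | apply: regular_atN; apply: regular_at_cst].
apply: regular_atV; last by rewrite mulf_neq0 ?pnatr_eq0.
apply: regular_atM; first exact: regular_at_cst.
by apply: regular_atD => //; apply: regular_atN.
Qed.

(** Taking [b x0 ^+ 2] for [B] makes the curve degenerate at [x0], where these finitely many
    inequalities are already known. *)
Lemma orbit_dist_generic (R : realFieldType) (x0 A : R) (a b : R -> R) N :
  regular_at x0 a -> regular_at x0 b -> a x0 != b x0 -> a x0 ^+ 2 < A ->
  generic x0 (fun x => orbit_defined (a x) (b x) A (b x0 ^+ 2) N /\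
    forall i, (i < N)%N -> forall j, (j < i)%N ->
      orbit_dist (a x) (b x) A (b x0 ^+ 2) i.+1 -
      orbit_dist (a x) (b x) A (b x0 ^+ 2) j.+1 != 0).
Proof.
move=> ra rb ab aA.
have d0 n := @orbit_degenerate_defined R (a x0) (b x0) A n ab aA.
apply: generic_and; apply: generic_forall => i _.
  have [rm rk] := orbit_regular ra rb (d0 i).
  have [rm' _] := orbit_regular ra rb (d0 i.+1).
  have [k0 m0] := d0 i.+1 i (ltnSn i).
  apply: generic_and; apply: generic_neq0 => //.
    by do !apply: regular_atD => //; apply: regular_atN.
  by apply: regular_atD => //; apply: regular_atN.
apply: generic_forall => j ji; apply: generic_neq0.
  by apply: regular_atD; first apply: orbit_dist_regular => //;
     last apply/regular_atN/orbit_dist_regular.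
rewrite subr_eq0; apply: contraTneq ji => /(orbit_degenerate_dist_inj ab aA) ->.
by rewrite ltnn.
Qed.

(** * Closure properties of the rational elements of [R] *)

Lemma rationalD (R : realType) (x y : R) : rational x -> rational y -> rational (x + y).
Proof. by move=> [p _ <-] [q _ <-]; exists (p + q); rewrite ?rmorphD. Qed.

Lemma rationalN (R : realType) (x : R) : rational x -> rational (- x).
Proof. by move=> [p _ <-]; exists (- p); rewrite ?rmorphN. Qed.

Lemma rationalM (R : realType) (x y : R) : rational x -> rational y -> rational (x * y).
Proof. by move=> [p _ <-] [q _ <-]; exists (p * q); rewrite ?rmorphM. Qed.

Lemma rationalV (R : realType) (x : R) : rational x -> rational x^-1.
Proof. by move=> [p _ <-]; exists p^-1; rewrite ?fmorphV. Qed.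

Lemma rational_nat (R : realType) n : rational (n%:R : R).
Proof. by exists n%:R; rewrite ?ratr_nat. Qed.

Lemma rational_norm (R : realType) (x : R) : rational x -> rational `|x|.
Proof. by case: (ger0P x) => // _; apply: rationalN. Qed.

Lemma rational_orbit (R : realType) (a b A B : R) n :
  rational a -> rational b -> rational A -> rational B ->
  rational (orbit a b A B n).1 /\ rational (orbit a b A B n).2.
Proof.
move=> ra rb rA rB; elim: n => [|n [rm rk]] /=.
  by split=> //; apply/rationalD/rationalN.
have rm' : rational (orbit a b A B n.+1).1.
  apply/rationalD/rationalN/rm/rationalM; last first.
    by apply/rationalV/rationalD/rationalN/ra/rationalD.
  apply/rationalN/rationalD/rationalN/rB/rationalD/rA/rationalD.
    exact: rationalM.
  apply/rationalN/rationalM/rk/rationalM/ra; exact: rational_nat.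
split=> //; apply/rationalD/rationalN/rk/rationalM; last first.
  by apply/rationalV/rationalD/rationalN.
apply/rationalN/rationalD/rA/rationalD; first exact: rationalM.
by apply/rationalN/rationalM/rm'/rationalM/ra; apply: rational_nat.
Qed.

(** * Restriction of polynomials to curves, and Zariski density *)

Lemma meval_poly (R : comNzRingType) n (f : {mpoly R[n]}) (v : 'I_n -> {poly R}) :
  exists g : {poly R}, forall x, g.[x] = f.@[fun i => (v i).[x]].
Proof.
exists (\sum_(m <- msupp f) f@_m *: \prod_i v i ^+ m i) => x.
rewrite mevalE horner_sum; apply: eq_bigr => m _.
by rewrite hornerZ horner_prod; congr (_ * _); apply: eq_bigr => i _; rewrite horner_exp.
Qed.

Lemma meval_line (R : comNzRingType) n (f : {mpoly R[n]}) (u : 'I_n -> R) :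
  exists2 g : {poly R}, (size g <= msize f)%N &
    forall x, g.[x] = f.@[fun i => x * u i].
Proof.
exists (\sum_(m <- msupp f) (f@_m * \prod_i u i ^+ m i) *: 'X^(mdeg m)).
  rewrite big_seq; elim/big_ind: _ => [|p q sp sq|m mf]; first by rewrite size_poly0.
    by rewrite (leq_trans (size_polyD _ _)) // geq_max sp.
  by rewrite (leq_trans (size_scale_leq _ _)) // size_polyXn msize_mdeg_lt.
move=> x; rewrite mevalE horner_sum; apply: eq_bigr => m _.
rewrite hornerZ hornerXn -mulrA; congr (_ * _).
rewrite mdegE -prodrXr -big_split /=; apply: eq_bigr => i _.
by rewrite exprMn mulrC.
Qed.

Lemma poly_nat_eq0 (R : numDomainType) (p : {poly R}) :
  (forall n, p.[n%:R] = 0) -> p = 0.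
Proof.
move=> p0; apply/eqP/negPn/negP => pn0.
have := @max_poly_roots _ p [seq n%:R | n <- iota 0 (size p)] pn0.
rewrite size_map size_iota ltnn => H; suff: false by []; apply: H.
  by apply/allP => _ /mapP[n _ ->]; apply/rootP.
by rewrite map_inj_uniq ?iota_uniq // => i j /eqP; rewrite eqr_nat => /eqP.
Qed.

Lemma zariski_denseP (R : realType) (S : set 'rV[R]_2) :
  zariski_dense S <-> forall f : {mpoly R[2]},
    (forall Q, S Q -> f.@[Q 0] = 0) -> forall Q : 'rV[R]_2, f.@[Q 0] = 0.
Proof.
split=> [dS f f0 Q|H].
  have : zariski_closure S Q by rewrite dS.
  move=> /(_ (zero_locus [set f])); apply=> //.
  by split=> [|Q' /f0 Q'0 _ ->]; first by exists [set f].
apply/seteqP; split=> // Q _ _ [[I ->] SI] f If.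
by apply: H => Q' /SI /(_ f If).
Qed.

Lemma zariski_dense_sub (R : realType) (S S' : set 'rV[R]_2) :
  S `<=` S' -> zariski_dense S -> zariski_dense S'.
Proof.
by move=> SS' /zariski_denseP dS; apply/zariski_denseP => f f0; apply: dS => Q /SS' /f0.
Qed.

(** * Scalar product and determinant in the plane *)

Definition cross (R : realType) (P Q : 'rV[R]_2) : R :=
  P 0 0 * Q 0 1 - P 0 1 * Q 0 0.

Lemma dotE (R : realType) (P Q : 'rV[R]_2) :
  dot P Q = P 0 0 * Q 0 0 + P 0 1 * Q 0 1.
Proof.
by rewrite /dot !big_ord_recl big_ord0 addr0; congr (_ + _ * _); congr (_ _ _);
  apply: val_inj.
Qed.

Lemma dotC (R : realType) (P Q : 'rV[R]_2) : dot P Q = dot Q P.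
Proof. by rewrite !dotE; ring. Qed.

Lemma dotDl (R : realType) (P Q X : 'rV[R]_2) : dot (P + Q) X = dot P X + dot Q X.
Proof. by rewrite !dotE !mxE; ring. Qed.

Lemma dotNl (R : realType) (P X : 'rV[R]_2) : dot (- P) X = - dot P X.
Proof. by rewrite !dotE !mxE; ring. Qed.

Lemma dotZl (R : realType) c (P X : 'rV[R]_2) : dot (c *: P) X = c * dot P X.
Proof. by rewrite !dotE !mxE; ring. Qed.

Lemma dotDr (R : realType) (P Q X : 'rV[R]_2) : dot X (P + Q) = dot X P + dot X Q.
Proof. by rewrite !dotE !mxE; ring. Qed.

Lemma dotNr (R : realType) (P X : 'rV[R]_2) : dot X (- P) = - dot X P.
Proof. by rewrite !dotE !mxE; ring. Qed.

Lemma dotZr (R : realType) c (P X : 'rV[R]_2) : dot X (c *: P) = c * dot X P.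
Proof. by rewrite !dotE !mxE; ring. Qed.

Definition dot_lin := (dotDl, dotDr, dotNl, dotNr, dotZl, dotZr).

(** Lagrange's identity: [cross P Q ^+ 2] is the Gram determinant. *)
Lemma dot_cross (R : realType) (P Q : 'rV[R]_2) :
  dot P P * dot Q Q = dot P Q ^+ 2 + cross P Q ^+ 2.
Proof. by rewrite !dotE /cross; ring. Qed.

Lemma dot_ge0 (R : realType) (P : 'rV[R]_2) : 0 <= dot P P.
Proof. by rewrite dotE -!expr2 addr_ge0 ?sqr_ge0. Qed.

Lemma dot_eq0 (R : realType) (P : 'rV[R]_2) : (dot P P == 0) = (P == 0).
Proof.
rewrite dotE -!expr2 paddr_eq0 ?sqr_ge0 // !sqrf_eq0.
apply/andP/eqP => [[/eqP p0 /eqP p1]|->]; last by rewrite !mxE !eqxx.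
apply/rowP => i; rewrite mxE.
by case: i => [[|[|]]] // ?; [rewrite -p0|rewrite -p1]; congr (P _ _); apply: val_inj.
Qed.

Lemma enorm_sqr (R : realType) (P : 'rV[R]_2) : enorm P ^+ 2 = dot P P.
Proof. exact/sqr_sqrtr/dot_ge0. Qed.

Lemma enormE (R : realType) (P : 'rV[R]_2) s : dot P P = s ^+ 2 -> enorm P = `|s|.
Proof. by rewrite /enorm => ->; rewrite sqrtr_sqr. Qed.

Lemma dot_basis_eq0 (R : realType) (P P' X : 'rV[R]_2) :
  cross P P' != 0 -> dot X P = 0 -> dot X P' = 0 -> X = 0.
Proof.
move=> c0 XP XP'; apply/eqP; rewrite -dot_eq0 -(mulrI_eq0 _ (mulfI c0)).
(* Cramer's rule expands [cross P P' *: X] in [P] and [P']; this is its scalar product with [X]. *)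
have -> : cross P P' * dot X X =
  dot X P * cross X P' + dot X P' * cross P X by rewrite !dotE /cross; ring.
by rewrite XP XP' !mul0r addr0.
Qed.

Lemma cross_neq0 (R : realType) (P P' : 'rV[R]_2) :
  ~ collinear 0 P P' -> cross P P' != 0.
Proof.
move=> nc; apply/eqP => c0; apply: nc.
have [P0|P0] := eqVneq P 0.
  (* A line needs a nonzero direction even if [P'] is zero as well. *)
  pose v := if P' == 0 then const_mx 1 else P'.
  exists 0, v; split.
    rewrite /v; case: ifPn => // _; apply/eqP => /rowP /(_ 0) /eqP.
    by rewrite !mxE oner_eq0.
  move=> _ [[->|->]|->]; [exists 0 => //| exists 0 => //|exists (P' != 0)%:R => //].
  - by rewrite scale0r addr0.
  - by rewrite P0 scale0r addr0.
  by rewrite /v; have [->|_] := eqVneq P' 0; rewrite ?scale0r ?scale1r add0r.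
exists 0, P; split=> // _ [[->|->]|->].
- by exists 0 => //; rewrite scale0r addr0.
- by exists 1 => //; rewrite scale1r add0r.
exists (dot P P' / dot P P) => //; rewrite add0r.
have PP0 : dot P P != 0 by rewrite dot_eq0.
apply/eqP; rewrite -subr_eq0 -dot_eq0 !dot_lin (dotC P' P).
have -> : dot P' P' = dot P P' ^+ 2 / dot P P.
  by apply: (mulfI PP0); rewrite dot_cross c0; field.
by apply/eqP; field.
Qed.

Lemma orthonormal_decomp (R : realType) (e f X : 'rV[R]_2) :
  dot e e = 1 -> dot e f = 0 -> dot f f != 0 ->
  X = dot X e *: e + (dot X f / dot f f) *: f.
Proof.
move=> ee ef ff0; have fe : dot f e = 0 by rewrite dotC.
have c0 : cross e f != 0.
  by rewrite -sqrf_eq0; have := dot_cross e f; rewrite ee ef mul1r expr0n add0r => <-.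
apply/eqP; rewrite -subr_eq0; apply/eqP/(dot_basis_eq0 c0); rewrite !dot_lin.
  by rewrite ee fe; ring.
by rewrite ef; field.
Qed.

(** Cramer's rule for the Gram system of [P] and [P'], which is rational with determinant [D]. *)
Lemma rational_combination (R : realType) (P P' Q : 'rV[R]_2) :
  cross P P' != 0 ->
  rational (dot P P) -> rational (dot P P') -> rational (dot P' P') ->
  rational (dot Q P) -> rational (dot Q P') -> rat_comb P P' Q.
Proof.
move=> c0 rA rg rB rx ry.
pose D := cross P P' ^+ 2.
have D0 : D != 0 by rewrite expf_neq0.
have DE : D = dot P P * dot P' P' - dot P P' ^+ 2 by rewrite dot_cross addrC addKr.
have rD : rational D.
  by rewrite DE; apply/rationalD/rationalN/rationalM => //; apply: rationalM.
have rdiv x y : rational x -> rational y -> rational (x / D).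
  by move=> ? ?; apply/rationalM/rationalV.
have [a _ aE] : rational ((dot P' P' * dot Q P - dot P P' * dot Q P') / D).
  apply/rationalM/rationalV/rD/rationalD/rationalN/rationalM => //.
  exact: rationalM.
have [b _ bE] : rational ((dot P P * dot Q P' - dot P P' * dot Q P) / D).
  apply/rationalM/rationalV/rD/rationalD/rationalN/rationalM => //.
  exact: rationalM.
exists a, b; apply/eqP; rewrite -subr_eq0; apply/eqP/(dot_basis_eq0 c0);
  rewrite !dot_lin aE bE ?(dotC P' P); apply: (mulfI D0); rewrite DE;
  by field; rewrite -DE.
Qed.

(** The three distances are the absolute values of [l], [l - m] and [k - l + m], which are rational
    along the orbit. *)
Lemma orbit_Jstar (R : realType) (P P' u : 'rV[R]_2) n :
  let a := dot u P in let b := dot u P' in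
  let A := dot P P in let B := dot P' P' in
  dot u u = 1 -> rational a -> rational b -> rational A -> rational B ->
  orbit_defined a b A B n.+1 ->
  Jstar P P' (orbit_dist a b A B n.+1 *: u).
Proof.
move=> a b A B uu ra rb rA rB dn.
have [] := orbit_dist_sqr dn.
have [] := rational_orbit n.+1 ra rb rA rB.
have : rational (orbit_dist a b A B n.+1).
  have [rm _] := rational_orbit n.+1 ra rb rA rB.
  apply/rationalM/rationalV/rationalM; last exact/rationalD/rationalN.
    by apply/rationalD/rationalN => //; apply: rationalM.
  exact: rational_nat.
set l := orbit_dist _ _ _ _ _; set m := (_).1; set k := (_).2.
move=> rl rm rk sE tE; split.
- rewrite (@enormE _ _ l) ?dot_lin ?uu; last by ring.
  exact: rational_norm.
- rewrite (@enormE _ _ (l - m)); last first.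
    by rewrite -sE !dot_lin uu (dotC P u) -/a -/A; ring.
  exact/rational_norm/rationalD/rationalN.
rewrite (@enormE _ _ (k - l + m)); last first.
  by rewrite -tE !dot_lin uu (dotC P' u) -/b -/B; ring.
by apply/rational_norm/rationalD => //; apply/rationalD/rationalN.
Qed.

(** * Rational parametrization of the unit circle *)

(* The rational parametrization of the unit circle of the plane, in the
   orthogonal basis [(e, f)] with [|e| = 1], by lines through [e]. *)
Definition circle_num (R : realType) (e f : 'rV[R]_2) (x : R) : 'rV[R]_2 :=
  (x ^+ 2 - dot f f) *: e + (2 * x) *: f.

Definition circle (R : realType) (e f : 'rV[R]_2) (x : R) : 'rV[R]_2 :=
  (x ^+ 2 + dot f f)^-1 *: circle_num e f x.

Lemma circle_den_neq0 (R : realType) (f : 'rV[R]_2) x :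
  dot f f != 0 -> x ^+ 2 + dot f f != 0.
Proof.
by move=> f0; rewrite gt_eqF // ltr_wpDl ?sqr_ge0 // lt_neqAle eq_sym f0 dot_ge0.
Qed.

Lemma circle_unit (R : realType) (e f : 'rV[R]_2) x :
  dot e e = 1 -> dot e f = 0 -> dot f f != 0 ->
  dot (circle e f x) (circle e f x) = 1.
Proof.
move=> ee ef ff0; rewrite !dot_lin ee (dotC f e) ef.
by field; rewrite circle_den_neq0.
Qed.

Lemma circle_regular (R : realType) (e f X : 'rV[R]_2) x0 : dot f f != 0 ->
  regular_at x0 (fun x => dot (circle e f x) X).
Proof.
move=> ff0.
exists (('X ^+ 2 - (dot f f)%:P) * (dot e X)%:P + 2%:P * 'X * (dot f X)%:P).
exists ('X ^+ 2 + (dot f f)%:P).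
split=> [|x _]; rewrite !(hornerE, hornerXn) ?circle_den_neq0 //.
by rewrite !dot_lin mulrC; congr (_ * _); ring.
Qed.

(** The line through [O] and [X] meets the circle in two opposite points; the sign of [r] is chosen
    so that [X / r] is not the missed point [e]. *)
Lemma circle_num_surj (R : realType) (e f X : 'rV[R]_2) :
  dot e e = 1 -> dot e f = 0 -> dot f f != 0 ->
  exists c x, X = c *: circle_num e f x.
Proof.
move=> ee ef ff0.
have [->|X0] := eqVneq X 0; first by exists 0, 0; rewrite scale0r.
pose D := dot f f; pose x := dot X e; pose y := dot X f / D.
have XE : X = x *: e + y *: f := orthonormal_decomp X ee ef ff0.
have nX : dot X X = x ^+ 2 + D * y ^+ 2.
  by rewrite XE !dot_lin ee (dotC f e) ef /D; ring.
pose r := if 0 <= x then - enorm X else enorm X.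
have r2 : r ^+ 2 = x ^+ 2 + D * y ^+ 2.
  by rewrite /r; case: ifP; rewrite ?sqrrN enorm_sqr.
have N0 : 0 < enorm X by rewrite sqrtr_gt0 lt_neqAle eq_sym dot_eq0 X0 dot_ge0.
have rx : r - x != 0.
  rewrite /r; case: lerP => hx; first by rewrite lt_eqF // ; lra.
  by rewrite gt_eqF //; lra.
(* The second witness is the parameter of [X / r], read off the slope of the line from [e] to it. *)
exists ((r - x) / (2 * D)), (D * y / (r - x)).
rewrite {1}XE /circle_num scalerDr !scalerA; congr (_ *: e + _ *: f); last first.
  by field; rewrite rx.
rewrite -/D; apply: (mulfI rx).
have -> : (r - x) * ((r - x) / (2 * D) * ((D * y / (r - x)) ^+ 2 - D)) =
   (D * y ^+ 2 - (r - x) ^+ 2) / 2 by field; rewrite rx.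
have -> : D * y ^+ 2 = r ^+ 2 - x ^+ 2 by rewrite r2; ring.
by field.
Qed.

(* The sign of [nu] is chosen so that [P' / nu] is not [e], the only point of
   the circle that the parametrization misses. *)
Lemma circle_parallel (R : realType) (e f P P' : 'rV[R]_2) :
  dot e e = 1 -> dot e f = 0 -> dot f f != 0 -> P' != 0 ->
  exists x nu, [/\ nu ^+ 2 = dot P' P', dot (circle e f x) P' = nu &
    dot (circle e f x) P = dot P P' / nu].
Proof.
move=> ee ef ff0 P'0.
pose nu := if dot P' e <= 0 then enorm P' else - enorm P'.
have N0 : 0 < enorm P' by rewrite sqrtr_gt0 lt_neqAle eq_sym dot_eq0 P'0 dot_ge0.
have nu2 : nu ^+ 2 = dot P' P' by rewrite /nu; case: ifP; rewrite ?sqrrN enorm_sqr.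
have nu0 : nu != 0 by rewrite -sqrf_eq0 nu2 dot_eq0.
pose D := dot f f.
have D0 : D != 0 by [].
pose x := dot P' e; pose y := dot P' f / D.
have P'E : P' = x *: e + y *: f := orthonormal_decomp P' ee ef ff0.
have nE : nu ^+ 2 = x ^+ 2 + D * y ^+ 2.
  by rewrite nu2 [in LHS]P'E !dot_lin ee (dotC f e) ef /D; ring.
have nux : nu - x != 0.
  rewrite /nu -/x; case: lerP => hx; first by rewrite gt_eqF //; lra.
  by rewrite lt_eqF //; lra.
have cE : circle e f (D * y / (nu - x)) = nu^-1 *: P'.
  rewrite P'E /circle /circle_num !scalerDr !scalerA -/D.
  have Dy : D * y ^+ 2 = nu ^+ 2 - x ^+ 2 by rewrite nE; ring.
  have dE : (D * y / (nu - x)) ^+ 2 + D = 2 * D * nu / (nu - x).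
    have -> : (D * y / (nu - x)) ^+ 2 = D * (D * y ^+ 2) / (nu - x) ^+ 2 by field.
    by rewrite Dy; field.
  rewrite dE; congr (_ *: e + _ *: f).
    have -> : (D * y / (nu - x)) ^+ 2 = D * (D * y ^+ 2) / (nu - x) ^+ 2 by field.
    by rewrite Dy; field; rewrite nu0 D0 nux.
  by field; rewrite nu0 D0 nux.
exists (D * y / (nu - x)), nu; split=> //; rewrite cE dot_lin.
  by rewrite -nu2; field.
by rewrite dotC mulrC.
Qed.

Lemma rational_circle (R : realType) (e f X : 'rV[R]_2) x :
  rational x -> rational (dot f f) -> rational (dot e X) -> rational (dot f X) ->
  rational (dot (circle e f x) X).
Proof.
move=> rx rff reX rfX; rewrite !dot_lin expr2.
apply/rationalM/rationalD/rationalM/rfX/rationalM/rx/rational_nat.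
  by apply/rationalV/rationalD => //; apply: rationalM.
by apply/rationalM => //; apply/rationalD/rationalN => //; apply: rationalM.
Qed.

(** * The equivalence in the rational case *)

(** On the line, [F] becomes a polynomial in [l] of size at most [msize F], with [msize F] distinct
    roots given by the orbit. *)
Lemma vanish_on_line (R : realType) (P P' u : 'rV[R]_2) (F : {mpoly R[2]}) :
  let a := dot u P in let b := dot u P' in
  let A := dot P P in let B := dot P' P' in
  (forall Q, Jstar P P' Q -> F.@[Q 0] = 0) ->
  dot u u = 1 -> rational a -> rational b -> rational A -> rational B ->
  orbit_defined a b A B (msize F) ->
  (forall i, (i < msize F)%N -> forall j, (j < i)%N ->
     orbit_dist a b A B i.+1 - orbit_dist a b A B j.+1 != 0) ->
  forall l, F.@[(l *: u) 0] = 0.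
Proof.
move=> a b A B F0 uu ra rb rA rB dn dist_neq l.
have [g sg gE] := meval_line F (u 0).
have {}gE x : g.[x] = F.@[(x *: u) 0].
  by rewrite gE; apply: meval_eq => i; rewrite mxE.
suff g0 : g = 0 by rewrite -gE g0 horner0.
apply/eqP/negPn/negP => gn0.
pose s := [seq orbit_dist a b A B i.+1 | i <- iota 0 (msize F)].
have := @max_poly_roots _ g s gn0; rewrite size_map size_iota ltnNge sg.
move=> H; suff: false by []; apply: H.
  apply/allP => _ /mapP[i + ->]; rewrite mem_iota add0n => /= iF.
  apply/rootP; rewrite gE; apply: F0.
  by apply: orbit_Jstar => // j ji; apply/dn/(leq_trans ji).
rewrite map_inj_in_uniq ?iota_uniq // => i j.
rewrite !mem_iota !add0n /= => iF jF ij.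
by case: (ltngtP i j) => // [ij'|ij']; [have := dist_neq _ jF _ ij'|have := dist_neq _ iF _ ij'];
  rewrite ij subrr eqxx.
Qed.

(** A polynomial vanishing on [Jstar P P'] vanishes on the lines directed by [circle e f x] for all
    rational [x] off a finite set, hence on all lines through [O]. *)
Lemma Jstar_dense_of_unit (R : realType) (P P' e : 'rV[R]_2) :
  cross P P' != 0 ->
  rational (dot P P) -> rational (dot P P') -> rational (dot P' P') ->
  dot e e = 1 -> rational (dot e P) -> rational (dot e P') ->
  dot P P' != dot P' P' -> zariski_dense (Jstar P P').
Proof.
move=> c0 rA rg rB ee reP reP' gB.
(* This vector is orthogonal to [e] and, unlike a unit normal, always has rational scalar products
   with [P] and [P']. *)
pose f := dot e P' *: P - dot e P *: P'.
have ef : dot e f = 0 by rewrite !dot_lin; ring.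
have rfP : rational (dot f P).
  by rewrite !dot_lin (dotC P' P); apply/rationalD/rationalN/rationalM => //;
    apply: rationalM.
have rfP' : rational (dot f P').
  by rewrite !dot_lin; apply/rationalD/rationalN/rationalM => //; apply: rationalM.
have rff : rational (dot f f).
  have -> : dot f f = dot e P' * dot f P - dot e P * dot f P'.
    by rewrite -!dotZr -dotNr -dotDr.
  apply/rationalD/rationalN/rationalM => //.
  exact: rationalM.
have e0 : e != 0 by rewrite -dot_eq0 ee oner_eq0.
have ff0 : dot f f != 0.
  rewrite dot_eq0; apply: contraNneq e0 => f0; apply/eqP/(dot_basis_eq0 c0).
    apply: (mulIf c0); rewrite mul0r.
    have -> : dot e P * cross P P' = - cross P f by rewrite /f /cross !mxE; ring.
    by rewrite f0 /cross !mxE; ring.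
  apply: (mulIf c0); rewrite mul0r.
  have -> : dot e P' * cross P P' = - cross P' f by rewrite /f /cross !mxE; ring.
  by rewrite f0 /cross !mxE; ring.
have P'0 : P' != 0 by apply: contraNneq c0 => ->; rewrite /cross !mxE !mulr0 subrr.
(* The parameter [x0] may be irrational: it only serves to test genericity. *)
have [x0 [nu [nu2 bE aE]]] := circle_parallel P ee ef ff0 P'0.
have nu0 : nu != 0 by rewrite -sqrf_eq0 nu2 dot_eq0.
apply/zariski_denseP => F F0.
have [q q0 qP] : generic x0 (fun x => forall l, rational x -> F.@[(l *: circle e f x) 0] = 0).
  have [] := @orbit_dist_generic R x0 (dot P P)
    (fun x => dot (circle e f x) P) (fun x => dot (circle e f x) P') (msize F).
  - exact: circle_regular.
  - exact: circle_regular.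
  (* At [x0], [a = dot P P' / nu] and [b = nu], so [a != b] is the hypothesis [gB]; the next
     condition is the strict Cauchy-Schwarz inequality. *)
  - rewrite aE bE; apply: contra_neq gB => gE; rewrite -nu2 expr2 -{1}gE.
    by rewrite divfK.
  - rewrite aE expr_div_n nu2 ltr_pdivrMr; last first.
      by rewrite -nu2 exprn_even_gt0.
    by rewrite dot_cross ltrDl exprn_even_gt0.
  rewrite bE nu2 => q q0 qP; exists q => // x /qP[dn dist_neq] l rx.
  have rdot X := @rational_circle R e f X x rx rff.
  apply: (@vanish_on_line R P P' (circle e f x)) l => //;
    [exact: circle_unit|exact: rdot|exact: rdot].
move=> X; have [c [x ->]] := circle_num_surj X ee ef ff0.
have [g gE] := meval_poly F
  (fun i => c%:P * (('X ^+ 2 - (dot f f)%:P) * (e 0 i)%:P + 2%:P * 'X * (f 0 i)%:P)).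
have {}gE y : g.[y] = F.@[(c *: circle_num e f y) 0].
  rewrite gE; apply: meval_eq => i; rewrite /circle_num !mxE.
  by rewrite !(hornerE, hornerXn).
(* The factor [q] absorbs the exceptional parameters; the natural numbers are enough rational
   parameters to conclude. *)
have gq0 : g * q = 0.
  apply: poly_nat_eq0 => n; rewrite hornerM.
  have [->|qn] := eqVneq q.[n%:R] 0; first by rewrite mulr0.
  have := qP _ qn (c * (n%:R ^+ 2 + dot f f)) (rational_nat _ n).
  by rewrite /circle scalerA mulfK ?circle_den_neq0 // -gE => ->; rewrite mul0r.
have qn0 : q != 0 by apply: contraNneq q0 => ->; rewrite horner0.
by rewrite -gE; move/eqP: gq0; rewrite mulf_eq0 (negPf qn0) orbF => /eqP ->; rewrite horner0.
Qed.

Lemma Jstar_sym (R : realType) (P P' : 'rV[R]_2) : Jstar P P' `<=` Jstar P' P.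
Proof. by move=> Q []. Qed.

Lemma Jstar_sub_J (R : realType) (P P' : 'rV[R]_2) : Jstar P P' `<=` J P P'.
Proof. by move=> Q []; split; rewrite expr2; apply: rationalM. Qed.

Lemma J_coord (R : realType) (P P' Q : 'rV[R]_2) : J P P' Q ->
  [/\ rational (dot Q Q), rational (2 * dot Q P - dot P P) &
      rational (2 * dot Q P' - dot P' P')].
Proof.
rewrite /J /= !enorm_sqr => -[rQ rP rP']; split=> //.
  have -> : 2 * dot Q P - dot P P = dot Q Q - dot (Q - P) (Q - P).
    by rewrite !dot_lin (dotC P Q); ring.
  exact/rationalD/rationalN.
have -> : 2 * dot Q P' - dot P' P' = dot Q Q - dot (Q - P') (Q - P').
  by rewrite !dot_lin (dotC P' Q); ring.
exact/rationalD/rationalN.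
Qed.

Lemma J_dots (R : realType) (P P' Q : 'rV[R]_2) :
  rational (dot P P) -> rational (dot P' P') -> J P P' Q ->
  rational (dot Q P) /\ rational (dot Q P').
Proof.
move=> rA rB /J_coord[_ rP rP'].
have r2 : rational (2^-1 : R) by apply/rationalV/rational_nat.
split.
  have -> : dot Q P = 2^-1 * (2 * dot Q P - dot P P + dot P P) by field.
  by apply/rationalM/rationalD.
have -> : dot Q P' = 2^-1 * (2 * dot Q P' - dot P' P' + dot P' P') by field.
by apply/rationalM/rationalD.
Qed.

Lemma Jstar_dense (R : realType) (P P' Q : 'rV[R]_2) :
  cross P P' != 0 ->
  rational (dot P P) -> rational (dot P P') -> rational (dot P' P') ->
  rat_comb P P' Q -> enorm Q != 0 -> rational (enorm Q) ->
  zariski_dense (Jstar P P').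
Proof.
move=> c0 rA rg rB [a [b QE]] nQ rQ.
pose e := (enorm Q)^-1 *: Q.
have ee : dot e e = 1 by rewrite !dot_lin -enorm_sqr; field.
have rV := rationalV rQ.
have [ra rb] : rational (ratr a : R) /\ rational (ratr b : R) by split; eexists.
have reP : rational (dot e P).
  rewrite /e {2}QE !dot_lin (dotC P' P).
  by apply/rationalM/rationalD; try apply: rationalM.
have reP' : rational (dot e P').
  rewrite /e {2}QE !dot_lin.
  by apply/rationalM/rationalD; try apply: rationalM.
(* If [dot P P' = dot P' P'], exchange [P] and [P']: were [dot P P] equal to them too, Lagrange's
   identity would give [cross P P' = 0]. *)
have [gB|gB] := eqVneq (dot P P') (dot P' P'); last first.
  exact: (@Jstar_dense_of_unit R P P' e).
apply: zariski_dense_sub (@Jstar_sym R P' P) _.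
apply: (@Jstar_dense_of_unit R P' P e) => //; rewrite 1?dotC //.
  by rewrite /cross; apply: contra_neq c0 => c0; rewrite /cross -[RHS]oppr0 -c0; ring.
apply: contraNneq c0 => gA; have := dot_cross P P'.
rewrite -gA -gB expr2 -[LHS]addr0 => /addrI /esym /eqP.
by rewrite sqrf_eq0.
Qed.

Lemma Jstar_dense_exists_rational_norm (R : realType) (P P' : 'rV[R]_2) :
  cross P P' != 0 ->
  rational (dot P P) -> rational (dot P P') -> rational (dot P' P') ->
  zariski_dense (Jstar P P') ->
  exists Q : 'rV[R]_2, [/\ rat_comb P P' Q, enorm Q != 0 & rational (enorm Q)].
Proof.
move=> c0 rA rg rB /zariski_denseP dJ.
have [[Q JQ Q0]|nQ] := pselect (exists2 Q, Jstar P P' Q & Q != 0).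
  have [rQP rQP'] := J_dots rA rB (Jstar_sub_J JQ).
  exists Q; split; first exact: rational_combination.
    by rewrite -sqrf_eq0 enorm_sqr dot_eq0.
  by case: JQ.
(* Otherwise [Jstar P P'] is contained in the origin, where the first coordinate vanishes, but not
   everywhere. *)
have := dJ 'X_0 _ (const_mx 1); rewrite mevalXU mxE => H.
suff: (1 : R) = 0 by move/eqP; rewrite oner_eq0.
apply: H => Q JQ; rewrite mevalXU; have [->|Q0] := eqVneq Q 0; first by rewrite mxE.
by case: nQ; exists Q.
Qed.

(** * Rationality of the scalar products when [J] is dense *)

(** A free family is grown inside [T]. If it gets stuck before [n] rows, [T] lies in its span, and a
    nonzero column of the cokernel matrix kills it. *)
Lemma rows_unit_or_annihilated (F : fieldType) n (T : set 'rV[F]_n) :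
  (exists2 M : 'M[F]_n, M \in unitmx & forall i, T (row i M)) \/
  (exists2 c : 'cV[F]_n, c != 0 & forall v, T v -> v *m c = 0).
Proof.
have [?|nc] := pselect (exists2 c : 'cV[F]_n, c != 0 & forall v, T v -> v *m c = 0).
  by right.
left; suff [M fM TM] : exists2 M : 'M[F]_n, row_free M & forall i, T (row i M).
  by exists M; rewrite -?row_free_unit.
suff H k : (k <= n)%N -> exists2 M : 'M[F]_(k, n), row_free M & forall i, T (row i M).
  exact: H.
elim: k => [_|k IHk kn].
  by exists 0 => [|[]//]; rewrite /row_free mxrank0.
have [M fM TM] := IHk (ltnW kn).
have [[v Tv vM]|vM] := pselect (exists2 v, T v & ~~ (v <= M)%MS).
  exists (col_mx v M : 'M_(1 + k, n)).
    have : (\rank M < \rank (v + M)%MS)%N.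
      apply: rank_ltmx; rewrite ltmxE addsmxSr /=.
      by apply: contra vM; apply: submx_trans; apply: addsmxSl.
    by rewrite addsmxE (eqP fM) /row_free eqn_leq rank_leq_row.
  move=> i; case: (split_ordP (i : 'I_(1 + k))) => j ->.
    by rewrite (rowKu j v M) row_id.
  by rewrite (rowKd j v M).
case: nc; have /matrix0Pn[i [j ij]] : cokermx M != 0.
  by rewrite -mxrank_eq0 mxrank_coker (eqP fM) -lt0n subn_gt0.
exists (col j (cokermx M)).
  by apply: contraNneq ij => /colP /(_ i); rewrite !mxE => ->.
move=> v Tv; rewrite colE mulmxA.
have /eqP -> : v *m cokermx M == 0.
  by rewrite -submxE; apply/negPn/negP => nv; apply: vM; exists v.
by rewrite mul0mx.
Qed.

Lemma rational_mulmx_unit (R : realType) n (M : 'M[rat]_n) (k : 'cV[R]_n) :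
  M \in unitmx -> (forall i, rational ((map_mx ratr M *m k) i 0)) ->
  forall i, rational (k i 0).
Proof.
move=> uM rk i.
have /choice[r rE] : forall j, exists q : rat, (map_mx ratr M *m k) j 0 = ratr q.
  by move=> j; have [q _ <-] := rk j; exists q.
have uM' : map_mx (ratr : rat -> R) M \in unitmx by rewrite map_unitmx.
have -> : k = map_mx ratr (invmx M *m \col_j r j).
  rewrite -[LHS](mulKmx uM') map_mxM map_invmx; congr (_ *m _).
  by apply/colP => j; rewrite rE !mxE.
by rewrite mxE; eexists.
Qed.

Definition monomials2 (R : pzRingType) (p q : R) : 'rV[R]_6 :=
  \row_i [:: p * p; p * q; q * q; p; q; 1]`_i.

Lemma monomials2_mul (R : pzRingType) (p q : R) (c : 'cV[R]_6) :
  (monomials2 p q *m c) 0 0 =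
  p * p * c 0 0 + p * q * c 1 0 + q * q * c 2 0 + p * c 3 0 + q * c 4 0 + c 5 0.
Proof.
rewrite mxE !big_ord_recl big_ord0 !mxE /= addr0 mul1r -!addrA.
by do !congr (_ + _); do ?congr (_ * _); congr (c _ _); apply: val_inj.
Qed.

Lemma map_monomials2 (R S : pzRingType) (h : {rmorphism R -> S}) (p q : R) :
  map_mx h (monomials2 p q) = monomials2 (h p) (h q).
Proof.
apply/rowP => -[[|[|[|[|[|[|]]]]]]] //= ?; by rewrite !mxE /= ?rmorphM ?rmorph1.
Qed.

(** The map from [Q] to [(p, q)] is an affine bijection of the plane, so the relation extends from
    [S] to all [(p, q)]. *)
Lemma dense_conic_eq0 (R : realType) (P P' : 'rV[R]_2) (S : set 'rV[R]_2) A B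
    (c : 'cV[R]_6) : cross P P' != 0 -> zariski_dense S ->
  (forall Q, S Q -> monomials2 (2 * dot Q P - A) (2 * dot Q P' - B) *m c = 0) ->
  c = 0.
Proof.
move=> c0 /zariski_denseP dS Sc.
have [coord coordE] : exists coord : 'rV[R]_2 -> R -> {mpoly R[2]},
    forall X a (Q : 'rV[R]_2), (coord X a).@[Q 0] = 2 * dot Q X - a.
  exists (fun X a => (2 * X 0 0) *: 'X_0 + (2 * X 0 1) *: 'X_1 - a%:MP) => X a Q.
  by rewrite mevalB mevalD !mevalZ !mevalXU mevalC dotE; ring.
pose F : {mpoly R[2]} := (monomials2 (coord P A) (coord P' B) *m map_mx (@mpolyC 2 R) c) 0 0.
have FE (Q : 'rV[R]_2) : F.@[Q 0] = (monomials2 (2 * dot Q P - A) (2 * dot Q P' - B) *m c) 0 0.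
  by rewrite /F !monomials2_mul !mxE !(mevalD, mevalM) !coordE !mevalC.
have F0 p q : (monomials2 p q *m c) 0 0 = 0.
  (* Cramer's rule gives the point with prescribed [p] and [q]. *)
  pose Q : 'rV[R]_2 := (((p + A) / 2) / cross P P') *: (\row_j [:: P' 0 1; - P' 0 0]`_j) +
            (((q + B) / 2) / cross P P') *: (\row_j [:: - P 0 1; P 0 0]`_j).
  have [QP QP'] : 2 * dot Q P - A = p /\ 2 * dot Q P' - B = q.
    move: c0; rewrite !dotE !mxE /= /cross => c0.
    by split; field.
  rewrite -{1}QP -{1}QP' -FE; apply: dS => Q' /Sc; rewrite FE => ->.
  by rewrite mxE.
have E p q := etrans (esym (monomials2_mul p q c)) (F0 p q).
(* Six points that lie on no common conic determine the six coefficients. *)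
have E00 := E 0 0; have E10 := E 1 0; have En0 := E (-1) 0.
have E01 := E 0 1; have E0n := E 0 (-1); have E11 := E 1 1.
apply/colP => i; rewrite [RHS]mxE.
have : i \in [:: 0; 1; 2; 3; 4; 5] by case: i => -[|[|[|[|[|[|]]]]]].
by rewrite !inE => /or4P[/eqP->|/eqP->|/eqP->|/or3P[] /eqP->]; lra.
Qed.

(* [4 D |Q|^2] is a polynomial of degree 2 in [p] and [q]: this is the
   vanishing of the Gram determinant of [Q, P, P'], where [D] is that of
   [P, P']. *)
Lemma gram_conic (R : realType) (P P' Q : 'rV[R]_2) :
  let A := dot P P in let B := dot P' P' in let g := dot P P' in
  let p := 2 * dot Q P - A in let q := 2 * dot Q P' - B in
  4 * cross P P' ^+ 2 * dot Q Q =
  p * p * B + p * q * (- (2 * g)) + q * q * A + p * (2 * B * (A - g)) +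
  q * (2 * A * (B - g)) + A * B * (A + B - 2 * g).
Proof. by rewrite /= !dotE /cross; ring. Qed.

Lemma J_dense_rational (R : realType) (P P' : 'rV[R]_2) :
  cross P P' != 0 -> zariski_dense (J P P') ->
  [/\ rational (dot P P), rational (dot P P') & rational (dot P' P')].
Proof.
move=> c0 dJ; set A := dot P P; set g := dot P P'; set B := dot P' P'.
(* The vectors are taken over [rat], so that a basis among them has a rational inverse. *)
pose T : set 'rV[rat]_6 := [set v | exists2 Q, J P P' Q &
  map_mx ratr v = monomials2 (2 * dot Q P - A) (2 * dot Q P' - B)].
have [[M uM TM]|[c cn0 Tc]] := rows_unit_or_annihilated T; last first.
  suff c00 : map_mx (ratr : rat -> R) c = 0.
    by move: cn0; rewrite -(map_mx_eq0 (ratr : {rmorphism rat -> R})) c00 eqxx.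
  apply: (dense_conic_eq0 (A := A) (B := B) c0 dJ) => Q JQ.
  have [_ [p _ pE] [q _ qE]] := J_coord JQ.
  rewrite -pE -qE -map_monomials2 -map_mxM Tc ?map_mx0 //.
  by exists Q => //; rewrite map_monomials2 -pE -qE.
pose d := (4 * cross P P' ^+ 2)^-1.
have d0 : d != 0 by rewrite invr_eq0 mulf_neq0 ?pnatr_eq0 // expf_neq0.
(* These are the coefficients of [gram_conic], divided so that it yields [dot Q Q]. *)
pose k : 'cV[R]_6 := d *: \col_i [:: B; - (2 * g); A; 2 * B * (A - g);
  2 * A * (B - g); A * B * (A + B - 2 * g)]`_i.
have rk : forall i, rational (k i 0).
  apply: (rational_mulmx_unit uM) => i; have [Q JQ QE] := TM i.
  have <- : row i (map_mx ratr M *m k) 0 0 = (map_mx ratr M *m k) i 0 by rewrite mxE.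
  rewrite row_mul -map_row QE monomials2_mul !mxE /=.
  have [[r _ rE] _ _] := J_coord JQ; exists r => //.
  have -> : ratr r = d * (4 * cross P P' ^+ 2 * dot Q Q).
    by rewrite rE /d mulKf // -invr_eq0.
  by rewrite gram_conic -/A -/B -/g; ring.
have rB := rk 0; have rg := rk 1; have rA := rk 2; have rBg := rk 3; have rAg := rk 4.
rewrite !mxE /= in rB rg rA rBg rAg.
have [A0 B0] : A != 0 /\ B != 0.
  by split; rewrite dot_eq0; apply: contraNneq c0 => ->; rewrite /cross !mxE; apply/eqP; ring.
have r2 : rational (2 : R) := rational_nat R 2.
have rAsg : rational (A - g).
  have -> : A - g = d * (2 * B * (A - g)) / (2 * (d * B)) by field; rewrite d0 B0.
  by apply/rationalM/rationalV/rationalM.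
have rBsg : rational (B - g).
  have -> : B - g = d * (2 * A * (B - g)) / (2 * (d * A)) by field; rewrite d0 A0.
  by apply/rationalM/rationalV/rationalM.
have rdg : rational (d * g).
  have -> : d * g = - (d * - (2 * g)) / 2 by field.
  by apply/rationalM/rationalV/r2/rationalN.
(* So far [A], [B], [g] are rational only up to the factor [d]. The linear coefficients made [A - g]
   and [B - g] rational, and dividing by a nonzero one recovers [d]. *)
suff rd : rational d.
  have dE x : x = d * x / d by field.
  by rewrite (dE A) (dE g) (dE B); split; apply/rationalM/rationalV.
have [Ag|Ag] := eqVneq (A - g) 0; last first.
  have -> : d = (d * A - d * g) / (A - g) by field.
  by apply/rationalM/rationalV => //; apply/rationalD/rationalN.
have [Bg|Bg] := eqVneq (B - g) 0; last first.
  have -> : d = (d * B - d * g) / (B - g) by field.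
  by apply/rationalM/rationalV => //; apply/rationalD/rationalN.
have : cross P P' ^+ 2 = 0.
  have := dot_cross P P'; rewrite -/A -/B -/g.
  move/eqP: Ag; move/eqP: Bg; rewrite !subr_eq0 => /eqP -> /eqP ->.
  by rewrite expr2 -[LHS]addr0 => /addrI.
by move/eqP; rewrite expf_eq0 /= (negPf c0).
Qed.

Theorem theorem5p2 (R : realType) (P P' : 'rV[R]_2)
    (hncol : ~ collinear 0 P P') :
  ([/\ rational (enorm P ^+ 2), rational (dot P P') & rational (enorm P' ^+ 2)] ->
     (zariski_dense (Jstar P P') <->
      exists Q : 'rV[R]_2,
        [/\ rat_comb P P' Q, enorm Q != 0 & rational (enorm Q)]))
  /\
  (~ [/\ rational (enorm P ^+ 2), rational (dot P P') & rational (enorm P' ^+ 2)] ->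
     ~ zariski_dense (J P P') /\ ~ zariski_dense (Jstar P P')).
Proof.
have c0 := cross_neq0 hncol; rewrite !enorm_sqr; split=> [[rA rg rB]|nr].
  split; first exact: Jstar_dense_exists_rational_norm.
  by move=> [Q [QPP' nQ rQ]]; apply: (@Jstar_dense R P P' Q).
have ndJ : ~ zariski_dense (J P P') by move/(J_dense_rational c0).
by split=> // /(zariski_dense_sub (@Jstar_sub_J R P P')).
Qed.
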